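(* Let $L$ be a chain, let $G$ be a group and $\mu\in L(G)$. Let $\eta$ be a maximal $L$-subgroup of $\mu$ and let $a_z$ be an $L$-point of $\mu$. Then either $\eta^{a_z}=\mu^{a_z}$ or $\eta^{a_z}$ is a maximal $L$-subgroup of $\mu^{a_z}$.
   Context: $L=\langle L,\le,\vee,\wedge\rangle$ is a completely distributive (complete) lattice with greatest element $1$ and least element $0$ (here assumed to be a chain, i.e. totally ordered). An $L$-subset of $G$ is a function $G\to L$; $\eta\subseteq\mu$ means $\eta(x)\le\mu(x)$ for all $x\in G$. An $L$-subset $\mu$ of $G$ is an $L$-subgroup of $G$ if $\mu(xy)\ge\mu(x)\wedge\mu(y)$ and $\mu(x^{-1})=\mu(x)$ for all $x,y\in G$; $L(G)$ is the set of $L$-subgroups of $G$. For $\mu\in L(G)$, $L(\mu)$ denotes the set of $\eta\in L(G)$ with $\eta\subseteq\mu$ (the $L$-subgroups of $\mu$). An $L$-subgroup $\eta$ of $\mu$ is proper if $\eta$ is non-constant and $\eta\neq\mu$. A proper $L$-subgroup $\eta$ of $\mu$ is a maximal $L$-subgroup of $\mu$ if, whenever $\eta\subseteq\theta\subseteq\mu$ for some $\theta\in L(\mu)$, then either $\theta=\eta$ or $\theta=\mu$. For $a\in L$ and $z\in G$, the $L$-point $a_z$ is the $L$-subset with value $a$ at $z$ and $0$ elsewhere; it is an $L$-point of $\mu$ (written $a_z\in\mu$) if $\mu(z)\ge a$. For $\eta\in L(\mu)$ (including $\eta=\mu$) and $a_z\in\mu$, the conjugate of $\eta$ by $a_z$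 is the $L$-subgroup $\eta^{a_z}$ of $\mu$ given by $\eta^{a_z}(x)=a\wedge\eta(zxz^{-1})$ for all $x\in G$. *)

(* Defs.v *)
From HB Require Import structures.
#[warning="-notation-overridden"] From mathcomp Require Import all_boot all_order.
From mathcomp Require Import boolp classical_sets.
Set Implicit Arguments.
Unset Strict Implicit.
Unset Printing Implicit Defensive.
Import Order.Theory.
Local Open Scope group_scope.
Local Open Scope order_scope.

Section CompleteLattices.
Context {d : Order.disp_t} (L : tbLatticeType d).

Definition complete_lattice : Prop :=
  forall A : set L, (supremums A !=set0 /\ infimums A !=set0)%classic.

(* The default values of [supremum] and [infimum] give the empty family its
   correct bounds: sup of set0 is \bot, inf of set0 is \top.  In a complete
   lattice they are thus the true sup and inf.  The law reads
   inf_i (sup (J i)) = sup_f (inf_i (f i)), with f ranging over the choice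
   functions of the family J. *)
Definition completely_distributive : Prop :=
  forall (I : Type) (J : I -> set L),
    infimum \top (range (fun i => supremum \bot (J i)))%classic =
    supremum \bot [set infimum \top (range f) |
                    f in [set f : I -> L | forall i, J i (f i)]]%classic.

End CompleteLattices.

Section LSubgroups.
Context {d : Order.disp_t} {L : tbLatticeType d} {G : groupType}.
Implicit Types (eta mu theta : G -> L) (a : L) (z : G).

Definition Lsubset eta mu : Prop := forall x, eta x <= mu x.

Definition is_Lsubgroup mu : Prop :=
  (forall x y : G, Order.meet (mu x) (mu y) <= mu (x * y)) /\
  (forall x : G, mu x^-1 = mu x).

(* eta \in L(mu); used only when mu is itself an L-subgroup of G. *)
Definition Lsubgroup_of eta mu : Prop := is_Lsubgroup eta /\ Lsubset eta mu.

Definition constant_Lsubset eta : Prop := exists c : L, forall x, eta x = c.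

Definition proper_Lsubgroup eta mu : Prop :=
  [/\ Lsubgroup_of eta mu, ~ constant_Lsubset eta & eta <> mu].

Definition maximal_Lsubgroup eta mu : Prop :=
  proper_Lsubgroup eta mu /\
  (forall theta, Lsubgroup_of theta mu -> Lsubset eta theta ->
     theta = eta \/ theta = mu).

(* The L-point a_z: value a at z and \bot elsewhere. *)
Definition Lpoint a z : G -> L := fun x => if x == z then a else \bot.

Definition Lpoint_of a z mu : Prop := a <= mu z.

Lemma Lpoint_ofE a z mu : Lpoint_of a z mu <-> Lsubset (Lpoint a z) mu.
Proof.
split=> [h x|/(_ z)]; rewrite /Lpoint; last by rewrite eqxx.
by case: eqP => [->|_] //; apply: le0x.
Qed.

(* The conjugate of eta by the L-point a_z. It takes the pair (a, z) rather
   than the function [Lpoint a z], which determines z only when a != \bot; for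
   a = \bot the conjugate is constantly \bot whatever z. *)
Definition Lconj eta a z : G -> L :=
  fun x => Order.meet a (eta (z * x * z^-1)).

Lemma Lconj_Lsubgroup eta a z : is_Lsubgroup eta -> is_Lsubgroup (Lconj eta a z).
Proof.
move=> [hM hV]; split=> [x y|x]; rewrite /Lconj.
  have -> : z * (x * y) * z^-1 = (z * x * z^-1) * (z * y * z^-1).
    by rewrite !mulgA mulgVK.
  by rewrite meetACA meetxx leI2.
by rewrite -[in RHS]hV !invgM invgK mulgA.
Qed.

Lemma Lconj_subset eta mu a z : is_Lsubgroup mu -> Lsubset eta mu ->
  Lpoint_of a z mu -> Lsubset (Lconj eta a z) mu.
Proof.
move=> [hM hV] hs ha x; rewrite /Lconj.
set w := (z * x * z^-1)%g.
have -> : x = z^-1 * w * z by rewrite /w !mulgA mulVg mul1g mulgVK.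
have az : Order.meet a (eta w) <= mu z by apply: le_trans (leIl _ _) ha.
apply: le_trans (hM _ _); rewrite lexI az andbT.
apply: le_trans (hM _ _); rewrite hV lexI az /=.
exact: le_trans (leIr _ _) (hs w).
Qed.

End LSubgroups.

(* Main.v *)
(** Undoing the conjugation by [z] turns an intermediate [theta] between the
    conjugates of [eta] and [mu] into an [L]-subgroup [phi] with
    [a /\ eta <= phi <= a /\ mu].  Level subsets of [phi] contain those of
    [eta] up to level [a] and are empty otherwise, so [eta \/ phi] is again an
    [L]-subgroup, lying between [eta] and [mu]; by maximality it is one of the
    two, and meeting with [a] gives [phi = a /\ eta] or [phi = a /\ mu].
    Totality of [L] matters only for properness: if the conjugate of [eta] is
    constant with value [c < a], then [eta] itself is constant. *)
Require Import Defs.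
From mathcomp Require Import all_boot all_order.
From mathcomp Require Import boolp.
Import Order.Theory.
Local Open Scope group_scope.
Local Open Scope order_scope.

(** Distributivity splits the meet of two joins into four terms. In a mixed term [eta x /\ phi y],
    the bound [phi y <= a] puts the term below [a /\ eta x], hence below [phi x]. *)
Lemma join_Lsubgroup (d : Order.disp_t) (L : tbDistrLatticeType d)
    (G : groupType) (eta phi : G -> L) (a : L) :
  is_Lsubgroup eta -> is_Lsubgroup phi ->
  (forall x, phi x <= a) -> (forall x, Order.meet a (eta x) <= phi x) ->
  is_Lsubgroup (fun x => Order.join (eta x) (phi x)).
Proof.
move=> [etaM etaV] [phiM phiV] phi_a eta_phi.
have mixed x y : Order.meet (eta x) (phi y) <= Order.meet (phi x) (phi y).
  rewrite lexI leIr andbT; apply: le_trans (eta_phi x).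
  by rewrite meetC leI2.
split=> [x y|x]; last by rewrite etaV phiV.
rewrite meetUl !meetUr !leUx; apply/andP; split; apply/andP; split.
- exact: le_trans (etaM x y) (leUl _ _).
- exact: le_trans (mixed x y) (le_trans (phiM x y) (leUr _ _)).
- rewrite meetC; apply: le_trans (mixed y x) _; rewrite meetC.
  exact: le_trans (phiM x y) (leUr _ _).
- exact: le_trans (phiM x y) (leUr _ _).
Qed.

Lemma Lconj_sandwich_maximal (d : Order.disp_t) (L : tbDistrLatticeType d)
    (G : groupType) (mu eta theta : G -> L) (a : L) (z : G) :
  maximal_Lsubgroup eta mu -> is_Lsubgroup theta ->
  Lsubset (Lconj eta a z) theta -> Lsubset theta (Lconj mu a z) ->
  theta = Lconj eta a z \/ theta = Lconj mu a z.
Proof.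
move=> [[[eta_sg eta_mu] _ _] eta_max] theta_sg eta_theta theta_mu.
have zK x : (z * (z^-1 * x * z^-1^-1) * z^-1)%g = x.
  by rewrite invgK !mulgA mulgV mul1g mulgK.
have zVK x : (z^-1 * (z * x * z^-1) * z^-1^-1)%g = x.
  by rewrite invgK !mulgA mulVg mul1g mulgVK.
(* Since [theta <= a], meeting with [a] loses nothing here, so [theta] can be recovered from
   [phi]. *)
pose phi := Lconj theta a z^-1.
have phi_a x : phi x <= a by apply: leIl.
have theta_a x : theta x <= a by apply: le_trans (theta_mu x) (leIl _ _).
have phiE x : phi (z * x * z^-1)%g = theta x.
  by rewrite /phi /Lconj zVK; apply/meet_r/theta_a.
have eta_phi x : Order.meet a (eta x) <= phi x.
  rewrite lexI leIl /=.
  by have := eta_theta (z^-1 * x * z^-1^-1)%g; rewrite /Lconj zK.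
have phi_mu x : phi x <= mu x.
  apply: le_trans (leIr _ _) (le_trans (theta_mu _) _).
  by rewrite /Lconj zK leIr.
have phi_sg : is_Lsubgroup phi by apply: Lconj_Lsubgroup.
pose psi x := Order.join (eta x) (phi x).
have psi_mu : Lsubset psi mu by move=> x; rewrite leUx eta_mu phi_mu.
have psi_sg : is_Lsubgroup psi by apply: join_Lsubgroup phi_a eta_phi.
have meet_psi x : Order.meet a (psi x) = phi x.
  by rewrite meetUr (meet_r (phi_a x)); apply/join_r/eta_phi.
have eta_psi : Lsubset eta psi by move=> x; apply: leUl.
(* In both cases [theta x] is [a /\ psi (z x z^-1)], which becomes a conjugate once [psi] is
   replaced. *)
case: (eta_max psi (conj psi_sg psi_mu) eta_psi) => psiE; [left | right];
  by apply/funext => x; rewrite -phiE -meet_psi psiE.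
Qed.

(** If [a /\ eta y = c < a] in a chain, then [a <= eta y] is impossible, so [eta y = c]. *)
Lemma Lconj_nonconstant (d : Order.disp_t) (L : tbOrderType d)
    (G : groupType) (eta : G -> L) (a : L) (z x : G) :
  ~ constant_Lsubset eta -> Lconj eta a z x < a ->
  ~ constant_Lsubset (Lconj eta a z).
Proof.
move=> eta_nc lt_a [c etaE]; apply: eta_nc; exists c => y.
have := etaE (z^-1 * y * z)%g; move: lt_a; rewrite etaE /Lconj.
rewrite !mulgA mulgV mul1g mulgK => lt_c.
by case: (leP a (eta y)) => // _ aE; rewrite aE ltxx in lt_c.
Qed.

Theorem theorem3p9 (d : Order.disp_t) (L : tbOrderType d) (G : groupType)
    (hL : complete_lattice L) (hLd : completely_distributive L)
    (mu eta : G -> L) (a : L) (z : G)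
    (hmu : is_Lsubgroup mu)
    (heta : maximal_Lsubgroup eta mu)
    (haz : Lpoint_of a z mu) :
  Lconj eta a z = Lconj mu a z \/
  maximal_Lsubgroup (Lconj eta a z) (Lconj mu a z).
Proof.
case: (pselect (Lconj eta a z = Lconj mu a z)) => [|neq]; [by left | right].
have [[[eta_sg eta_mu] eta_nc _] _] := heta.
have sub : Lsubset (Lconj eta a z) (Lconj mu a z) by move=> x; apply: leI2.
split; last first.
  by move=> theta [theta_sg theta_mu] /Lconj_sandwich_maximal; apply.
split=> //; first by split=> //; apply: Lconj_Lsubgroup.
have [x neq_x] : exists x, Lconj eta a z x <> Lconj mu a z x.
  by apply/existsNP => eqx; apply/neq/funext.
(* Where the conjugates differ, that of [eta] is strictly below that of [mu], hence below [a]. *)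
apply: (@Lconj_nonconstant _ _ _ _ _ _ x eta_nc).
apply: lt_le_trans (leIl a (mu (z * x * z^-1)%g)).
by rewrite lt_neqAle; apply/andP; split; [apply/eqP | apply: sub].
Qed.
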